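(* Let $(R,\mathfrak m,k)$ be a Cohen--Macaulay local ring of dimension $d>0$ with canonical module $\omega_R$. Suppose that there exist an exact sequence of $R$-modules $0\to R\to\omega_R\to C\to0$ with $C\neq0$ and a sequence $x_1,\ldots,x_{d-1}\in\mathfrak m$ that is regular on both $R$ and $C$, such that $C/(x_1,\ldots,x_{d-1})C$ has $k$ as a direct summand. Then $R$ is G-regular and satisfies the generalized Auslander--Reiten condition.
   Context: $R$ is G-regular if every finitely generated totally reflexive $R$-module is free; a finitely generated $R$-module $M$ is totally reflexive if $M$ is reflexive and $\operatorname{Ext}_R^i(M,R)=\operatorname{Ext}_R^i(\operatorname{Hom}_R(M,R),R)=0$ for all $i>0$. $R$ satisfies the generalized Auslander--Reiten condition if every finitely generated $R$-module $M$ satisfying $\operatorname{Ext}_R^i(M,M\oplus R)=0$ for all $i\gg0$ has finite projective dimension. (It is known that this is equivalent to the symmetric Auslander condition: for every finitely generated $R$-module $M$, if $\operatorname{Ext}_R^i(M,R)=0$ for all $i>0$ and $\operatorname{Ext}_R^i(M,M)=0$ for all $i\gg0$, then $\operatorname{Ext}_R^i(M,M)=0$ for all $i>0$.) When $d=1$ the sequence $x_1,\ldots,x_{d-1}$ is empty. The hypothesis on $R$ is the paper's definition of ''$R$ satisfies condition $(\ast)$''. *)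

(* Defs.v *)
From HB Require Import structures.
From mathcomp Require Import all_boot all_algebra.
From mathcomp Require Import generic_quotient ring_quotient.
From mathcomp Require Import finmap boolp classical_sets.
From mathcomp.multinomials Require Import monalg.

Set Implicit Arguments.
Unset Strict Implicit.
Unset Printing Implicit Defensive.

Import GRing.Theory.
Local Open Scope ring_scope.
Local Open Scope classical_set_scope.
Local Open Scope quotient_scope.

Definition submodule (R : comNzRingType) (M : lmodType R) (N : set M) : Prop :=
  N 0 /\ forall (a : R) (x y : M), N x -> N y -> N (a *: x + y).

Definition span (R : comNzRingType) (M : lmodType R) (S : set M) : set M :=
  [set x | forall N : set M, submodule N -> S `<=` N -> N x].

Section SpanPred.
Variables (R : comNzRingType) (M : lmodType R) (S : set M).

Definition span_pred : {pred M} := fun x => `[< span S x >].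

Lemma span_pred_submod_closed : submod_closed span_pred.
Proof.
split=> [|a x y]; first by apply/asboolP => N [].
move=> /asboolP xS /asboolP yS; apply/asboolP => N sN SN.
by apply: sN.2; [apply: xS | apply: yS].
Qed.

HB.instance Definition _ :=
  GRing.isSubmodClosed.Build R M span_pred span_pred_submod_closed.

End SpanPred.

(* M / <S>; the submodule generated by S is S itself when S is a submodule. *)
Definition quo (R : comNzRingType) (M : lmodType R) (S : set M) : Type :=
  Quotient.quot (span_pred S).

Section Quo.
Variables (R : comNzRingType) (M : lmodType R) (S : set M).

HB.instance Definition _ := GRing.Zmodule.on (quo S).
HB.instance Definition _ := EqQuotient.on (quo S).

Definition quo_scale (a : R) (u : quo S) : quo S := \pi_(quo S) (a *: repr u).

Lemma quo_pi_scale (a : R) (x : M) :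
  quo_scale a (\pi_(quo S) x) = \pi_(quo S) (a *: x).
Proof.
apply/eqP; rewrite /quo_scale -Quotient.idealrBE -scalerBr.
by apply: rpredZ; rewrite Quotient.idealrBE reprK.
Qed.

Lemma quo_piD (x y : M) :
  \pi_(quo S) (x + y) = \pi_(quo S) x + \pi_(quo S) y.
Proof. exact: (Quotient.pi_add (span_pred S) x y). Qed.

Lemma quo_scaleA a b u : quo_scale a (quo_scale b u) = quo_scale (a * b) u.
Proof.
rewrite -[u]reprK (quo_pi_scale b) (quo_pi_scale a) (quo_pi_scale (a * b)).
by rewrite scalerA.
Qed.

Lemma quo_scale1 : left_id 1 quo_scale.
Proof. by move=> u; rewrite -[u]reprK quo_pi_scale scale1r. Qed.

Lemma quo_scaleDr : right_distributive quo_scale +%R.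
Proof.
by move=> a u v; rewrite -[u]reprK -[v]reprK -quo_piD !quo_pi_scale
  scalerDr quo_piD.
Qed.

Lemma quo_scaleDl u : {morph quo_scale^~ u : a b / a + b}.
Proof. by move=> a b; rewrite -[u]reprK !quo_pi_scale scalerDl quo_piD. Qed.

HB.instance Definition _ := GRing.Zmodule_isLmodule.Build R (quo S)
  quo_scaleA quo_scale1 quo_scaleDr quo_scaleDl.

End Quo.

Section Kernel.
Variables (R : comNzRingType) (M N : lmodType R) (f : {linear M -> N}).

Definition ker_pred : {pred M} := [pred x | f x == 0].

Lemma ker_pred_submod_closed : submod_closed ker_pred.
Proof.
split=> [|a x y]; rewrite !inE ?linear0 // => /eqP fx /eqP fy.
by rewrite linearP fx fy scaler0 addr0.
Qed.

HB.instance Definition _ :=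
  GRing.isSubmodClosed.Build R M ker_pred ker_pred_submod_closed.

Record ker : Type := Ker { ker_val : M; _ : ker_val \in ker_pred }.

HB.instance Definition _ := [isSub for ker_val].
HB.instance Definition _ := [Choice of ker by <:].
HB.instance Definition _ := [SubChoice_isSubZmodule of ker by <:].
HB.instance Definition _ := [SubZmodule_isSubLmodule of ker by <:].

Lemma ker_valP (z : ker) : f (ker_val z) = 0.
Proof. by case: z => x /=; rewrite inE => /eqP. Qed.

End Kernel.

Definition hom (R : comNzRingType) (M N : lmodType R) : Type := {linear M -> N}.

Section Hom.
Variables (R : comNzRingType) (M N : lmodType R).

HB.instance Definition _ := gen_eqMixin (hom M N).
HB.instance Definition _ := gen_choiceMixin (hom M N).

Lemma homP (u v : hom M N) : u =1 v -> u = v.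
Proof.
case: u v => [u [[uA] [uZ]]] [v [[vA] [vZ]]] /= /funext uv.
rewrite {}uv in uA uZ *.
by rewrite (Prop_irrelevance uA vA) (Prop_irrelevance uZ vZ).
Qed.

Lemma hom_zero_linear : linear (fun _ : M => 0 : N).
Proof. by move=> a x y; rewrite scaler0 addr0. Qed.

Lemma hom_opp_linear (u : hom M N) : linear (fun x : M => - u x : N).
Proof. by move=> a x y; rewrite linearP opprD scalerN. Qed.

Lemma hom_add_linear (u v : hom M N) : linear (fun x : M => u x + v x : N).
Proof. by move=> a x y; rewrite !linearP scalerDr addrACA. Qed.

Lemma hom_scale_linear (b : R) (u : hom M N) : linear (fun x : M => b *: u x).
Proof.
by move=> a x y; rewrite linearP scalerDr !scalerA [b * a]mulrC.
Qed.

Definition mk_hom (f : M -> N) (lf : linear f) : hom M N :=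
  HB.pack f (GRing.isLinear.Build R M N _ f lf).

Definition hom_zero : hom M N := mk_hom hom_zero_linear.
Definition hom_opp (u : hom M N) : hom M N := mk_hom (hom_opp_linear u).
Definition hom_add (u v : hom M N) : hom M N := mk_hom (hom_add_linear u v).
Definition hom_scale (b : R) (u : hom M N) : hom M N :=
  mk_hom (hom_scale_linear b u).

Lemma hom_addA : associative hom_add.
Proof. by move=> u v w; apply: homP => x /=; rewrite addrA. Qed.

Lemma hom_addC : commutative hom_add.
Proof. by move=> u v; apply: homP => x /=; rewrite addrC. Qed.

Lemma hom_add0 : left_id hom_zero hom_add.
Proof. by move=> u; apply: homP => x /=; rewrite add0r. Qed.

Lemma hom_addN : left_inverse hom_zero hom_opp hom_add.
Proof. by move=> u; apply: homP => x /=; rewrite addNr. Qed.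

HB.instance Definition _ := GRing.isZmodule.Build (hom M N)
  hom_addA hom_addC hom_add0 hom_addN.

Lemma hom_scaleA a b u : hom_scale a (hom_scale b u) = hom_scale (a * b) u.
Proof. by apply: homP => x /=; rewrite scalerA. Qed.

Lemma hom_scale1 : left_id 1 hom_scale.
Proof. by move=> u; apply: homP => x /=; rewrite scale1r. Qed.

Lemma hom_scaleDr : right_distributive hom_scale +%R.
Proof. by move=> a u v; apply: homP => x /=; rewrite scalerDr. Qed.

Lemma hom_scaleDl u : {morph hom_scale^~ u : a b / a + b}.
Proof. by move=> a b; apply: homP => x /=; rewrite scalerDl. Qed.

HB.instance Definition _ := GRing.Zmodule_isLmodule.Build R (hom M N)
  hom_scaleA hom_scale1 hom_scaleDr hom_scaleDl.

End Hom.

Section Precomp.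
Variables (R : comNzRingType) (A B N : lmodType R) (f : {linear A -> B}).

Lemma hom_comp_linear (u : hom B N) : linear (fun x : A => u (f x)).
Proof. by move=> a x y; rewrite !linearP. Qed.

Definition precomp_fun (u : hom B N) : hom A N := mk_hom (hom_comp_linear u).

Lemma precomp_linear : linear precomp_fun.
Proof. by move=> a u v; apply: homP. Qed.

(* Hom(f, N) : Hom(B, N) -> Hom(A, N) *)
Definition precomp : {linear hom B N -> hom A N} := mk_hom precomp_linear.

End Precomp.

Definition dual (R : comNzRingType) (M : lmodType R) : lmodType R := hom M R^o.

Section Biduality.
Variables (R : comNzRingType) (M : lmodType R).

Lemma evaluation_linear (x : M) : linear (fun u : dual M => (u : hom M R^o) x).
Proof. by []. Qed.

Definition evaluation (x : M) : dual (dual M) := mk_hom (evaluation_linear x).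

End Biduality.

Definition reflexive_module (R : comNzRingType) (M : lmodType R) : Prop :=
  bijective (@evaluation R M).

Definition surjective (A B : Type) (f : A -> B) : Prop :=
  forall y : B, exists x : A, f x = y.

Definition exact_at (R : comNzRingType) (A B C : lmodType R)
    (f : {linear A -> B}) (g : {linear B -> C}) : Prop :=
  forall y : B, g y = 0 <-> exists x : A, f x = y.

Definition short_exact (R : comNzRingType) (A B C : lmodType R)
    (f : {linear A -> B}) (g : {linear B -> C}) : Prop :=
  [/\ injective f, exact_at f g & surjective g].

Definition lmod_iso (R : comNzRingType) (M N : lmodType R) : Prop :=
  exists f : {linear M -> N}, bijective f.

Definition zero_module (R : comNzRingType) (M : lmodType R) : Prop :=
  forall x : M, x = 0.

Definition direct_summand (R : comNzRingType) (M N : lmodType R) : Prop :=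
  exists L : lmodType R, lmod_iso (M * L)%type N.

Definition finitely_generated (R : comNzRingType) (M : lmodType R) : Prop :=
  exists s : seq M, span [set x | x \in s] = setT.

(* For a finitely generated module over a nonzero commutative ring, free means
   free of finite rank. *)
Definition free_fin (R : comNzRingType) (M : lmodType R) : Prop :=
  exists n : nat, lmod_iso 'rV[R]_n M.

Definition projective_module (R : comNzRingType) (P : lmodType R) : Prop :=
  forall (A B : lmodType R) (p : {linear A -> B}) (u : {linear P -> B}),
    surjective p -> exists v : {linear P -> A}, forall x, p (v x) = u x.

Definition injective_module (R : comNzRingType) (E : lmodType R) : Prop :=
  forall (A B : lmodType R) (j : {linear A -> B}) (u : {linear A -> E}),
    injective j -> exists v : {linear B -> E}, forall x, v (j x) = u x.

Record proj_resolution (R : comNzRingType) (M : lmodType R) := ProjResolution {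
  pr_obj : nat -> lmodType R;
  pr_diff : forall i, {linear pr_obj i.+1 -> pr_obj i};
  pr_aug : {linear pr_obj 0 -> M};
  pr_projective : forall i, projective_module (pr_obj i);
  pr_aug_surj : surjective pr_aug;
  pr_exact0 : exact_at (pr_diff 0) pr_aug;
  pr_exactS : forall i, exact_at (pr_diff i.+1) (pr_diff i)
}.

Record inj_resolution (R : comNzRingType) (N : lmodType R) := InjResolution {
  ir_obj : nat -> lmodType R;
  ir_diff : forall i, {linear ir_obj i -> ir_obj i.+1};
  ir_coaug : {linear N -> ir_obj 0};
  ir_injective : forall i, injective_module (ir_obj i);
  ir_coaug_inj : injective ir_coaug;
  ir_exact0 : exact_at ir_coaug (ir_diff 0);
  ir_exactS : forall i, exact_at (ir_diff i) (ir_diff i.+1)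
}.

Definition finite_proj_dim (R : comNzRingType) (M : lmodType R) : Prop :=
  exists (P : proj_resolution M) (n : nat),
    forall i, (n < i)%N -> zero_module (pr_obj P i).

Definition finite_inj_dim (R : comNzRingType) (N : lmodType R) : Prop :=
  exists (I : inj_resolution N) (n : nat),
    forall i, (n < i)%N -> zero_module (ir_obj I i).

Section FreeModule.
Variables (R : comNzRingType) (K : choiceType) (M : lmodType R) (h : K -> M).

Definition malg_lift_fun (g : {malg R[K]}) : M :=
  \sum_(k <- msupp g) g@_k *: h k.

Lemma malg_lift_funEw (d : {fset K}) (g : {malg R[K]}) :
  (msupp g `<=` d)%fset -> malg_lift_fun g = \sum_(k <- d) g@_k *: h k.
Proof.
move=> le; rewrite [LHS](big_fset_incl _ le) => //= x xd /mcoeff_outdom ->.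
by rewrite scale0r.
Qed.

Lemma malg_lift_linear : linear malg_lift_fun.
Proof.
move=> a u v; pose d := (msupp u `|` msupp v)%fset.
have ud : (msupp u `<=` d)%fset by apply: fsubsetUl.
have vd : (msupp v `<=` d)%fset by apply: fsubsetUr.
have uvd : (msupp (a *: u + v) `<=` d)%fset.
  apply: (fsubset_trans (msuppD_le _ _)); apply: fsetUSS => //.
  exact: msuppZ_le.
rewrite (malg_lift_funEw ud) (malg_lift_funEw vd) (malg_lift_funEw uvd).
rewrite scaler_sumr -big_split /=; apply: eq_bigr => k _.
by rewrite mcoeffD mcoeffZ scalerDl scalerA.
Qed.

Definition malg_lift : {linear {malg R[K]} -> M} := mk_hom malg_lift_linear.

Lemma malg_liftU (k : K) : malg_lift << k >> = h k.
Proof.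
by rewrite /= (malg_lift_funEw msuppU_le) big_seq_fset1 mcoeffUU scale1r.
Qed.

End FreeModule.

Lemma malg_projective (R : comNzRingType) (K : choiceType) :
  projective_module {malg R[K]}.
Proof.
move=> A B p u psurj.
have /choice[h hE] : forall k : K, exists x : A, p x = u << k >> by [].
exists (malg_lift h) => g.
rewrite [in RHS](monalgE g) linear_sum /= /malg_lift_fun linear_sum /=.
apply: eq_bigr => k _; rewrite linearZ /= hE -linearZ /=; congr (u _).
by apply/malgP => k'; rewrite mcoeffZ !mcoeffU mulr_natr.
Qed.

Section FreeResolution.
Variables (R : comNzRingType).

(* The free module on the underlying set of M, with its canonical map to M. *)
Definition free_cover (M : lmodType R) : lmodType R := {malg R[M]}.

Definition free_cover_map (M : lmodType R) : {linear free_cover M -> M} :=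
  malg_lift (@id M).

Lemma free_cover_surj (M : lmodType R) : surjective (free_cover_map M).
Proof. by move=> x; exists << x >>; apply: malg_liftU. Qed.

Variable M : lmodType R.

Fixpoint free_syzygy (i : nat) : lmodType R :=
  if i is j.+1 then ker (free_cover_map (free_syzygy j)) else M.

Definition free_res_obj (i : nat) : lmodType R := free_cover (free_syzygy i).

Lemma free_res_diff_linear (i : nat) :
  linear (fun x : free_res_obj i.+1 =>
    ker_val (free_cover_map (free_syzygy i.+1) x) : free_res_obj i).
Proof. by move=> a x y; rewrite linearP. Qed.

Definition free_res_diff (i : nat) :
    {linear free_res_obj i.+1 -> free_res_obj i} :=
  mk_hom (@free_res_diff_linear i).

Lemma free_res_exact (i : nat) :
  exact_at (free_res_diff i) (free_cover_map (free_syzygy i)).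
Proof.
move=> y; split=> [fy | [x <-]] /=; last first.
  exact: (ker_valP (f := free_cover_map (free_syzygy i))
    (free_cover_map (free_syzygy i.+1) x)).
have yk : y \in ker_pred (free_cover_map (free_syzygy i)) by rewrite inE fy.
have [x xE] := free_cover_surj (Ker yk : free_syzygy i.+1).
by exists x => /=; rewrite [malg_lift_fun _ _]xE.
Qed.

Lemma ker_val_inj (A B : lmodType R) (f : {linear A -> B}) :
  injective (@ker_val R A B f).
Proof. exact: val_inj. Qed.

Lemma free_res_exactS (i : nat) :
  exact_at (free_res_diff i.+1) (free_res_diff i).
Proof.
move=> y; rewrite -(@free_res_exact i.+1 y); split=> /= h; last by rewrite [malg_lift_fun _ _]h.
by apply: ker_val_inj; rewrite [LHS]h.
Qed.

Definition free_resolution : proj_resolution M :=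
  @ProjResolution R M free_res_obj free_res_diff (free_cover_map M)
    (fun i => @malg_projective R (free_syzygy i)) (free_cover_surj (M := M))
    (@free_res_exact 0) free_res_exactS.

End FreeResolution.

Section Ext.
Variables (R : comNzRingType) (M : lmodType R).

Definition cocycles (P : proj_resolution M) (N : lmodType R) (i : nat)
    : lmodType R :=
  ker (precomp N (pr_diff P i)).

Definition coboundaries (P : proj_resolution M) (N : lmodType R) (i : nat)
    : set (cocycles P N i) :=
  match i return set (cocycles P N i) with
  | 0 => [set 0]
  | j.+1 => [set z | exists u : hom (pr_obj P j) N,
                       ker_val z = precomp N (pr_diff P j) u]
  end.

(* H^i(Hom(P, N)) *)
Definition Ext_of (P : proj_resolution M) (N : lmodType R) (i : nat)
    : lmodType R :=
  quo (@coboundaries P N i).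

End Ext.

Definition Ext (R : comNzRingType) (i : nat) (M N : lmodType R) : lmodType R :=
  Ext_of (free_resolution M) N i.

Definition totally_reflexive (R : comNzRingType) (M : lmodType R) : Prop :=
  [/\ finitely_generated M, reflexive_module M &
      forall i, (0 < i)%N ->
        zero_module (Ext i M R^o) /\ zero_module (Ext i (dual M) R^o)].

Definition G_regular (R : comNzRingType) : Prop :=
  forall M : lmodType R,
    finitely_generated M -> totally_reflexive M -> free_fin M.

Definition generalized_Auslander_Reiten (R : comNzRingType) : Prop :=
  forall M : lmodType R, finitely_generated M ->
    (exists n, forall i, (n <= i)%N -> zero_module (Ext i M (M * R^o)%type)) ->
    finite_proj_dim M.

Definition ideal (R : comNzRingType) (I : set R) : Prop :=
  submodule (I : set R^o).

Definition prime_ideal (R : comNzRingType) (p : set R) : Prop :=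
  [/\ ideal p, ~ p 1 & forall a b, p (a * b) -> p a \/ p b].

Definition maximal_ideal (R : comNzRingType) (m : set R) : Prop :=
  [/\ ideal m, m <> setT &
      forall I : set R, ideal I -> m `<=` I -> I = m \/ I = setT].

Definition noetherian (R : comNzRingType) : Prop :=
  forall I : set R, ideal I ->
    exists s : seq R, span ([set x | x \in s] : set R^o) = I.

Definition local_ring (R : comNzRingType) (m : set R) : Prop :=
  maximal_ideal m /\ forall n : set R, maximal_ideal n -> n = m.

Definition prime_chain (R : comNzRingType) (n : nat) (p : nat -> set R) : Prop :=
  (forall i, (i <= n)%N -> prime_ideal (p i)) /\
  (forall i, (i < n)%N -> p i `<` p i.+1).

Definition krull_dim (R : comNzRingType) (d : nat) : Prop :=
  (exists p : nat -> set R, prime_chain d p) /\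
  (forall (n : nat) (p : nat -> set R), prime_chain n p -> (n <= d)%N).

(* M / (x_1, ..., x_n) M *)
Definition mod_seq (R : comNzRingType) (M : lmodType R) (xs : seq R)
    : lmodType R :=
  quo [set y : M | exists2 a : R, a \in xs & exists z : M, y = a *: z].

Definition regular_sequence (R : comNzRingType) (M : lmodType R) (xs : seq R)
    : Prop :=
  (forall i, (i < size xs)%N ->
     forall z : mod_seq M (take i xs), xs`_i *: z = 0 -> z = 0) /\
  ~ zero_module (mod_seq M xs).

Definition depth (R : comNzRingType) (m : set R) (M : lmodType R) (t : nat)
    : Prop :=
  (exists xs : seq R,
     [/\ forall a, a \in xs -> m a, regular_sequence M xs & size xs = t]) /\
  (forall xs : seq R, (forall a, a \in xs -> m a) -> regular_sequence M xs ->
     (size xs <= t)%N).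

Definition residue_field (R : comNzRingType) (m : set R) : lmodType R :=
  quo (m : set R^o).

Definition cohen_macaulay_local (R : comNzRingType) (m : set R) (d : nat)
    : Prop :=
  [/\ noetherian R, local_ring m, krull_dim R d & depth m R^o d].

(* type M = r, i.e. dim_k Ext^t(k, M) = r where t = depth M *)
Definition cm_type (R : comNzRingType) (m : set R) (M : lmodType R) (r : nat)
    : Prop :=
  exists t : nat, depth m M t /\
    lmod_iso {ffun 'I_r -> residue_field m} (Ext t (residue_field m) M).

(* Bruns-Herzog: a maximal Cohen-Macaulay module of type 1 and of finite
   injective dimension. *)
Definition canonical_module (R : comNzRingType) (m : set R) (w : lmodType R)
    : Prop :=
  [/\ finitely_generated w,
      exists2 d : nat, krull_dim R d & depth m w d,
      cm_type m w 1 & finite_inj_dim w].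

(* Main.v *)
(* Let M be finitely generated with Ext^i(M, R) = 0 for i >> 0.  Since omega has
   finite injective dimension, Ext^i(M, omega) = 0 for i >> 0, so the sequence
   0 -> R -> omega -> C -> 0 gives Ext^i(M, C) = 0 for i >> 0.  Dividing by the
   C-regular sequence xs preserves this, and k is a summand of C/xs C, so
   Ext^i(M, k) = 0 for i >> 0.  Hence a high syzygy of M is free: a hom from the
   kernel K of a minimal cover R^n -> L to k which extends to R^n vanishes, as K
   lies in m R^n, and this forces K = 0.  So M has finite projective dimension.
   If moreover Ext^i(M, R) = 0 for all i > 0, then a free syzygy splits off the
   preceding cover, which makes the preceding syzygy free, and so on to M. *)
Require Import Defs.
From mathcomp Require Import all_boot all_algebra.
From mathcomp Require Import generic_quotient boolp classical_sets.

Set Implicit Arguments.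
Unset Strict Implicit.
Unset Printing Implicit Defensive.

Import GRing.Theory.
Local Open Scope ring_scope.
Local Open Scope classical_set_scope.

(** * Factoring linear maps through surjections, injections and kernels *)

Section LinearMaps.
Variable R : comNzRingType.
Implicit Types A B N X Y : lmodType R.

Lemma linear_inj A B (f : {linear A -> B}) :
  (forall x, f x = 0 -> x = 0) -> injective f.
Proof.
move=> f0 x y fxy; apply/eqP; rewrite -subr_eq0; apply/eqP/f0.
by rewrite linearB fxy subrr.
Qed.

Lemma inj_surj_bij (A B : Type) (f : A -> B) :
  injective f -> surjective f -> bijective f.
Proof.
move=> finj /choice[g gK]; exists g => // x; exact/finj/gK.
Qed.

(** Composing [z] with a set-theoretic section of [p] is linear, because [z] is constant on the
    fibres of [p]. *)
Lemma factor_surj A B N (p : {linear A -> B}) (z : {linear A -> N}) :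
  surjective p -> (forall x, p x = 0 -> z x = 0) ->
  exists u : {linear B -> N}, forall x, u (p x) = z x.
Proof.
move=> /choice[s sK] pz.
have zs x y : p x = p y -> z x = z y.
  move=> pxy; apply/eqP; rewrite -subr_eq0 -linearB; apply/eqP/pz.
  by rewrite linearB pxy subrr.
have lin : linear (fun y => z (s y)).
  by move=> a x y; rewrite -linearP; apply: zs; rewrite linearP !sK.
by exists (mk_hom lin) => x; apply: zs.
Qed.

Lemma factor_inj A X Y (f : {linear X -> Y}) (w : {linear A -> Y}) :
  injective f -> (forall a, exists x, f x = w a) ->
  exists v : {linear A -> X}, forall a, f (v a) = w a.
Proof.
move=> finj /choice[v vK].
have lin : linear v by move=> a x y; apply: finj; rewrite linearP !vK linearP.
by exists (mk_hom lin).
Qed.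

Lemma factor_ker A X Y (f : {linear X -> Y}) (w : {linear A -> X}) :
  (forall a, f (w a) = 0) ->
  exists v : {linear A -> ker f}, forall a, ker_val (v a) = w a.
Proof.
move=> fw.
have k a : w a \in ker_pred f by rewrite inE fw.
have lin : linear (fun a => Ker (k a)).
  by move=> a x y; apply: ker_val_inj; rewrite /= linearP.
by exists (mk_hom lin).
Qed.

Lemma ker_val_linear X Y (f : {linear X -> Y}) : linear (@ker_val R X Y f).
Proof. by []. Qed.

Definition ker_incl X Y (f : {linear X -> Y}) : {linear ker f -> X} :=
  mk_hom (@ker_val_linear X Y f).

Lemma ker_incl_exact X Y (f : {linear X -> Y}) : exact_at (ker_incl f) f.
Proof.
move=> x; split=> [fx|[z <-]]; last exact: ker_valP.
by have k : x \in ker_pred f; [rewrite inE fx | exists (Ker k)].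
Qed.

End LinearMaps.

(** * The quotient map and its kernel *)

Section Quotient.
Variables (R : comNzRingType) (M : lmodType R) (S : set M).

Lemma quo_pi_linear : linear (fun x : M => \pi_(quo S)%qT x).
Proof. by move=> a x y; rewrite quo_piD -quo_pi_scale. Qed.

Definition quo_map : {linear M -> quo S} := mk_hom quo_pi_linear.

Lemma quo_map_surj : surjective quo_map.
Proof. by move=> u; exists (repr u); rewrite /= reprK. Qed.

Lemma quo_map0 (x : M) : quo_map x = 0 <-> Defs.span S x.
Proof.
split.
  move=> h; have : \pi_(quo S)%qT x = \pi_(quo S)%qT 0.
    by rewrite -[LHS]/(quo_map x) h -[RHS]/(quo_map 0) linear0.
  by move/eqP; rewrite -Quotient.idealrBE subr0 => /asboolP.
move=> h; have : \pi_(quo S)%qT x = \pi_(quo S)%qT 0.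
  by apply/eqP; rewrite -Quotient.idealrBE subr0; apply/asboolP.
by rewrite -[LHS]/(quo_map x) -[RHS]/(quo_map 0) linear0.
Qed.

End Quotient.

(** * Vanishing of Ext^1 as extendability of maps defined on a first syzygy *)

Section Extensions.
Variable R : comNzRingType.
Implicit Types A B N P Q X Y Z : lmodType R.

(* For P projective and p surjective onto A, this says Ext^1(A, N) = 0. *)
Definition extends P A (p : {linear P -> A}) N : Prop :=
  forall u : {linear ker p -> N},
    exists v : {linear P -> N}, forall z, v (ker_val z) = u z.

Lemma extends_retract P A (p : {linear P -> A}) X Y
    (s : {linear X -> Y}) (r : {linear Y -> X}) :
  cancel s r -> extends p Y -> extends p X.
Proof.
move=> sK pY u; have [v vE] := pY (s \o u).
by exists (r \o v) => z /=; rewrite vE /= sK.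
Qed.

Lemma extends_injective P A (p : {linear P -> A}) N :
  injective_module N -> extends p N.
Proof.
move=> injN u.
have [|v vE] := injN _ _ (ker_incl p) u; first exact: ker_val_inj.
by exists v.
Qed.

Section LongExact.
Variables (P P' A X Y Z : lmodType R) (p : {linear P -> A}).
Variables (q : {linear P' -> ker p}).
Variables (f : {linear X -> Y}) (g : {linear Y -> Z}).
Hypotheses (qsurj : surjective q) (fg : short_exact f g).

(** The segment Ext^1(A, Y) -> Ext^1(A, Z) -> Ext^2(A, X) of the long exact sequence, with [ker q]
    as second syzygy of [A]. The map [u \o q] lifts to [w] into [Y]; [w] sends [ker q] into [X], and
    subtracting an extension of that restriction makes [w] descend to a lift of [u] on [ker p]. *)
Lemma extends_cokernel : projective_module P' ->
  extends p Y -> extends q X -> extends p Z.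
Proof.
case: fg => finj fgex gsurj P'proj pY qX u.
have [w wE] := P'proj _ _ g (u \o q) gsurj.
have [|w' w'E] := factor_inj (w := w \o ker_incl q) finj.
  by move=> z; apply/fgex; rewrite /= wE /= ker_valP linear0.
have [v vE] := qX w'.
have [||u' u'E] := @factor_surj _ _ _ _ q (w \- (f \o v)) => //.
  move=> x /ker_incl_exact[z <-] /=.
  by rewrite vE w'E subrr.
have [t tE] := pY u'.
exists (g \o t) => z /=; have [x <-] := qsurj z.
rewrite tE u'E /= linearB wE /=.
have gf : g (f (v x)) = 0 by apply/fgex; exists (v x).
by rewrite gf subr0.
Qed.

(** The segment Ext^1(A, Z) -> Ext^2(A, X) -> Ext^2(A, Y). An extension [v] of [f \o u] induces a
    map [ker p -> Z]; this extends to [P] and lifts to [t'] into [Y]. Correcting [v] by [t'] moves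
    its image into [X] without changing it on [ker q]. *)
Lemma extends_kernel : projective_module P ->
  extends p Z -> extends q Y -> extends q X.
Proof.
case: fg => finj fgex gsurj Pproj pZ qY u.
have [v vE] := qY (f \o u).
have [||w wE] := @factor_surj _ _ _ _ q (g \o v) => //.
  move=> x /ker_incl_exact[z <-] /=.
  by rewrite vE /=; apply/fgex; exists (u z).
have [t tE] := pZ w.
have [t' t'E] := Pproj _ _ g t gsurj.
have [|v' v'E] :=
    factor_inj (w := v \- (t' \o (ker_incl p \o q))) finj.
  by move=> x; apply/fgex; rewrite /= linearB t'E tE wE subrr.
exists v' => z; apply: finj.
have qz : ker_val (q (ker_val z)) = 0 by rewrite ker_valP.
by rewrite v'E /= vE /= qz linear0 subr0.
Qed.

End LongExact.

End Extensions.

(** * Vanishing of Ext, computed on the canonical free resolution *)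

Section ExtVanishing.
Variables (R : comNzRingType) (M : lmodType R).
Implicit Types N X Y Z : lmodType R.

(** The index is shifted by one: Ext^1 of the [i]-th syzygy is Ext^(i+1) of [M]. *)
Definition Ext_vanishes (i : nat) N : Prop :=
  extends (free_cover_map (free_syzygy M i)) N.

Lemma submodule_coboundaries (P : proj_resolution M) N i :
  submodule (@coboundaries _ _ P N i).
Proof.
case: i => [|i] /=; first by split=> // a x y -> ->; rewrite scaler0 addr0.
split=> [|a x y [u ux] [v vy]]; first by exists 0; apply: homP.
exists (a *: u + v); apply: homP => t.
have /= xt := congr1 (fun h : Defs.hom _ _ => h t) ux.
have /= yt := congr1 (fun h : Defs.hom _ _ => h t) vy.
by rewrite /= xt yt.
Qed.

(** Degree [i.+1] cocycles are the maps that factor through [p i.+1], hence correspond to maps on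
    the syzygy [ker (p i)]; coboundaries correspond to those that extend to the free cover. *)
Lemma Ext_vanishesP i N : zero_module (Ext i.+1 M N) <-> Ext_vanishes i N.
Proof.
pose p j := free_cover_map (free_syzygy M j).
have psurj j : surjective (p j) by apply: free_cover_surj.
split=> [E0 u | E0 c].
  pose c : Defs.hom _ N := (u : {linear _ -> _}) \o p i.+1.
  have c0 : precomp N (pr_diff (free_resolution M) i.+1) c = 0.
    apply: homP => x.
    exact: etrans (congr1 u (ker_valP (p i.+2 x))) (linear0 u).
  have ck : c \in ker_pred (precomp N (pr_diff (free_resolution M) i.+1)).
    by rewrite inE c0.
  have /quo_map0 :=
    E0 (quo_map (@coboundaries _ _ (free_resolution M) N i.+1) (Ker ck)).
  move/(_ _ (@submodule_coboundaries _ _ i.+1) (@subset_refl _ _)) => [v /= cv].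
  exists v => z; have [x <-] := psurj i.+1 z.
  by rewrite -[u _]/(c x) cv.
have [z <-] := quo_map_surj c.
apply/quo_map0 => C _; apply.
have [|u uE] := factor_surj (z := ker_val z) (psurj i.+1).
  move=> x /free_res_exact[y <-].
  exact: (congr1 (fun h : Defs.hom _ _ => h y) (ker_valP z)).
have [v vE] := E0 u.
by exists v; apply: homP => x; rewrite /= -uE -vE.
Qed.

Lemma Ext_vanishes_retract i X Y (s : {linear X -> Y}) (r : {linear Y -> X}) :
  cancel s r -> Ext_vanishes i Y -> Ext_vanishes i X.
Proof. exact: extends_retract. Qed.

Lemma Ext_vanishes_cokernel i X Y Z
    (f : {linear X -> Y}) (g : {linear Y -> Z}) :
  short_exact f g -> Ext_vanishes i Y -> Ext_vanishes i.+1 X ->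
  Ext_vanishes i Z.
Proof.
move=> fg; apply: (extends_cokernel _ fg); first exact: free_cover_surj.
exact: malg_projective.
Qed.

Lemma Ext_vanishes_kernel i X Y Z (f : {linear X -> Y}) (g : {linear Y -> Z}) :
  short_exact f g -> Ext_vanishes i Z -> Ext_vanishes i.+1 Y ->
  Ext_vanishes i.+1 X.
Proof.
move=> fg; apply: (extends_kernel _ fg); first exact: free_cover_surj.
exact: malg_projective.
Qed.

(** Dimension shifting along the exact sequences from [Z j] to [ir_obj I j] to [Z j.+1], starting
    from the cosyzygies [Z j] with [n < j], which are zero. *)
Lemma Ext_vanishes_finite_inj_dim N : finite_inj_dim N ->
  exists n, forall i, (n <= i)%N -> Ext_vanishes i N.
Proof.
move=> [I [n I0]].
pose Z j := ker (ir_diff I j).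
have cor j : exists h : {linear ir_obj I j -> Z j.+1},
    forall x, ker_val (h x) = ir_diff I j x.
  by apply: factor_ker => x; apply/ir_exactS; exists x.
have step j X (f : {linear X -> ir_obj I j}) : injective f ->
    exact_at f (ir_diff I j) ->
    forall i, Ext_vanishes i (Z j.+1) -> Ext_vanishes i.+1 X.
  move=> finj fex i Zi; have [h hE] := cor j.
  have fh : short_exact f h.
    split=> // [y|z].
      rewrite -fex -hE; split=> [->|hy]; first by [].
      by apply: ker_val_inj; rewrite hy.
    have /ir_exactS[x xz] := ker_valP z; exists x.
    by apply: ker_val_inj; rewrite hE.
  apply: (Ext_vanishes_kernel fh Zi).
  exact/extends_injective/ir_injective.
have top j i : (n < j)%N -> Ext_vanishes i (Z j).
  move=> nj u; exists (hom_zero _ _) => z.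
  by apply: ker_val_inj; rewrite [LHS]I0 // [RHS]I0.
have all k : forall j i, (n < j + k)%N -> (k <= i)%N -> Ext_vanishes i (Z j).
  elim: k => [|k IH] j i; first by rewrite addn0 => /top.
  case: i => // i njk ki.
  apply: (step j _ (ker_incl _)); [exact: ker_val_inj|exact: ker_incl_exact|].
  by apply: IH => //; rewrite addSnnS.
(* One shift leads from [N] to [Z 1], and [n] further shifts reach [Z n.+1], which is zero. *)
exists n.+1 => -[//|i] ni; apply: (step 0 _ (ir_coaug I)).
- exact: ir_coaug_inj.
- exact: ir_exact0.
- by apply: (all n) => //; rewrite add1n.
Qed.

End ExtVanishing.

(** * Projective modules, projective dimension and stable retracts *)

Section Projective.
Variable R : comNzRingType.
Implicit Types A B N P Q M : lmodType R.

Definition rV_lift n M (h : 'I_n -> M) (v : 'rV[R]_n) : M :=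
  \sum_i v 0 i *: h i.

Lemma rV_lift_linear n M (h : 'I_n -> M) : linear (rV_lift h).
Proof.
move=> a v w; rewrite /rV_lift scaler_sumr -big_split /=.
by apply: eq_bigr => i _; rewrite !mxE scalerDl scalerA.
Qed.

Lemma rV_linearE n M (p : {linear 'rV[R]_n -> M}) v :
  p v = \sum_i v 0 i *: p (delta_mx 0 i).
Proof.
rewrite {1}[v]row_sum_delta linear_sum; apply: eq_bigr => i _.
by rewrite linearZ.
Qed.

Lemma rV_lift_delta n M (h : 'I_n -> M) i : rV_lift h (delta_mx 0 i) = h i.
Proof.
rewrite /rV_lift (bigD1 i) //= big1 ?addr0 => [|j /negPf ji].
  by rewrite mxE !eqxx scale1r.
by rewrite mxE ji andbF scale0r.
Qed.

Lemma rV_projective n : projective_module 'rV[R]_n.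
Proof.
move=> A B p u /choice[s sK].
exists (mk_hom (rV_lift_linear (fun i => s (u (delta_mx 0 i))))) => v.
rewrite [in RHS]rV_linearE /= /rV_lift linear_sum; apply: eq_bigr => i _.
by rewrite linearZ /= sK.
Qed.

Lemma projective_retract P Q (s : {linear P -> Q}) (r : {linear Q -> P}) :
  cancel s r -> projective_module Q -> projective_module P.
Proof.
move=> sK Qproj A B p u psurj.
have [v vE] := Qproj _ _ p (u \o r) psurj.
by exists (v \o s) => x; rewrite /= vE /= sK.
Qed.

Lemma free_fin_projective P : free_fin P -> projective_module P.
Proof.
move=> [n [f [g fK gK]]].
have glin : linear g.
  by move=> a x y; apply: (can_inj fK); rewrite gK linearP !gK.
apply: (projective_retract (s := mk_hom glin) (r := f)) => //.
exact: rV_projective.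
Qed.

Lemma projective_finite_proj_dim P : projective_module P -> finite_proj_dim P.
Proof.
move=> Pproj.
(* ['rV[R]_0] serves as the zero module in positive degrees. *)
pose obj i : lmodType R := if i is 0 then P else 'rV[R]_0.
have obj0 i (x y : obj i.+1) : x = y.
  by change (x = y :> 'rV[R]_0); rewrite [x]thinmx0 [y]thinmx0.
pose diff i : {linear obj i.+1 -> obj i} := hom_zero _ _.
have idlin : linear (fun x : P => x) by [].
unshelve eexists (@ProjResolution R P obj diff (mk_hom idlin) _ _ _ _), 0%N.
- by case=> [|i] //; apply: rV_projective.
- by move=> x; exists x.
- move=> x; split=> [/= ->|[y <-]] //.
  by exists 0.
- move=> i x; split=> [_|[y <-]] //.
  by exists 0; apply: obj0.
- by case=> // i _ x; apply: obj0.
Qed.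

(** A resolution of [ker p], shifted by one degree, is spliced with [p]. *)
Lemma finite_proj_dim_ker P M (p : {linear P -> M}) :
  projective_module P -> surjective p -> finite_proj_dim (ker p) ->
  finite_proj_dim M.
Proof.
move=> Pproj psurj [r [n r0]].
pose obj i : lmodType R := if i is j.+1 then pr_obj r j else P.
pose diff i : {linear obj i.+1 -> obj i} :=
  match i with 0 => ker_incl p \o pr_aug r | j.+1 => pr_diff r j end.
unshelve eexists (@ProjResolution R M obj diff p _ psurj _ _), n.+1.
- by case=> [|i] //; apply: pr_projective.
- move=> x; split=> [/ker_incl_exact[z <-]|[y <-]] /=; last exact: ker_valP.
  by have [y <-] := pr_aug_surj r z; exists y.
- case=> [|i]; last exact: pr_exactS.
  move=> x; rewrite -(@pr_exact0 _ _ r); split=> [|/= ->] //.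
  exact: (@ker_val_inj _ _ _ p _ 0).
- by case=> // i ni; apply: r0.
Qed.

(* A is a retract of B up to a map through a projective module; by the proof of
   Schanuel's lemma this passes to syzygies. *)
Definition stable_retract A B : Prop :=
  exists (Q : lmodType R) (a : {linear A -> B}) (b : {linear B -> A})
         (s : {linear A -> Q}) (t : {linear Q -> A}),
    projective_module Q /\ forall x, b (a x) = x + t (s x).

Lemma stable_retract_refl A : stable_retract A A.
Proof.
have idlin : linear (fun x : A => x) by [].
exists 'rV[R]_0, (mk_hom idlin), (mk_hom idlin), (hom_zero _ _), (hom_zero _ _).
by split=> [|x /=]; [apply: rV_projective | rewrite addr0].
Qed.

Section Syzygy.
Variables (A B P P' : lmodType R) (p : {linear P -> A}) (p' : {linear P' -> B}).
Hypotheses (Pproj : projective_module P) (P'proj : projective_module P').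
Hypotheses (psurj : surjective p) (p'surj : surjective p').
Hypothesis AB : stable_retract A B.

(** The lifts of [a] and [b] to the covers compose to the identity plus a lift of [t \o s \o p], up
    to an error [h] with values in [ker p]. On [ker p] the middle term vanishes, so [b1 \o a1]
    differs from the identity by a map that factors through [P]. *)
Lemma stable_retract_ker_maps :
  exists (a0 : {linear P -> P'}) (a1 : {linear ker p -> ker p'})
         (b1 : {linear ker p' -> ker p}) (h : {linear P -> ker p}),
    (forall z, ker_val (a1 z) = a0 (ker_val z)) /\
    (forall z, b1 (a1 z) = z + h (ker_val z)).
Proof.
have [Q [a [b [s [t [Qproj ba]]]]]] := AB.
have [a0 a0E] := Pproj (a \o p) p'surj.
have [b0 b0E] := P'proj (b \o p') psurj.
have [t0 t0E] := Qproj _ _ p t psurj.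
have [|a1 a1E] := factor_ker (f := p') (w := a0 \o ker_incl p).
  by move=> z; rewrite /= a0E /= ker_valP linear0.
have [|b1 b1E] := factor_ker (f := p) (w := b0 \o ker_incl p').
  by move=> z; rewrite /= b0E /= ker_valP linear0.
have idlin : linear (fun x : P => x) by [].
have [|h hE] :=
    factor_ker (f := p) (w := (b0 \o a0) \- (mk_hom idlin \+ (t0 \o (s \o p)))).
  by move=> x; rewrite /= linearB linearD b0E /= a0E /= ba t0E subrr.
exists a0, a1, b1, h; split=> // z; apply: ker_val_inj.
rewrite b1E /= a1E /=.
rewrite -[RHS]/(ker_val z + ker_val (h (ker_val z))).
by rewrite hE /= ker_valP !linear0 addr0 addrC subrK.
Qed.

Lemma stable_retract_ker : stable_retract (ker p) (ker p').
Proof.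
have [a0 [a1 [b1 [h [_ ba]]]]] := stable_retract_ker_maps.
by exists P, a1, b1, (ker_incl p), h.
Qed.

(** If [w] extends [u \o b1], then [w \o a0] restricts on [ker p] to [u] plus the restriction of
    [u \o h], and the latter is already defined on all of [P]. *)
Lemma stable_retract_extends N : extends p' N -> extends p N.
Proof.
have [a0 [a1 [b1 [h [a1E ba]]]]] := stable_retract_ker_maps.
move=> p'N u; have [w wE] := p'N (u \o b1).
exists ((w \o a0) \- (u \o h)) => z /=.
by rewrite -a1E wE /= ba linearD addrK.
Qed.

End Syzygy.

Lemma extends_rV P A (p : {linear P -> A}) n :
  extends p R^o -> extends p 'rV[R]_n.
Proof.
move=> pR u.
have clin i : linear (fun z => u z 0 i : R^o).
  by move=> a x y; rewrite linearP !mxE.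
have /choice[v vE] i := pR (mk_hom (clin i)).
have vlin : linear (fun x => \row_i v i x).
  by move=> a x y; apply/rowP => i; rewrite !mxE linearP.
by exists (mk_hom vlin) => z; apply/rowP => i; rewrite mxE vE.
Qed.

Lemma extends_free_fin P A (p : {linear P -> A}) N :
  extends p R^o -> free_fin N -> extends p N.
Proof.
move=> pR [n [f [f' fK f'K]]].
have f'lin : linear f'.
  by move=> a x y; apply: (can_inj fK); rewrite f'K linearP !f'K.
apply: (extends_retract (s := mk_hom f'lin) (r := f)) => //.
exact: extends_rV.
Qed.

(** Extending the identity of [ker p] splits [p]. With [ker p] free, this turns vanishing of Ext^1
    into the ring into vanishing into every module. *)
Lemma extends_ker P A (p : {linear P -> A}) N :
  extends p (ker p) -> extends p N.
Proof.
have idlin : linear (fun z : ker p => z) by [].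
move=> /(_ (mk_hom idlin))[r rE] u.
by exists (u \o r) => z; rewrite /= rE.
Qed.

End Projective.

(** * Noetherian modules and finite generation of syzygies *)

Section Noetherian.
Variable R : comNzRingType.
Implicit Types A B C M : lmodType R.

Local Notation gen s := (Defs.span [set x | x \in s]).

Lemma span_submodule M (S : set M) : submodule (Defs.span S).
Proof.
split=> [N [] //|a x y xS yS N sN SN]; apply: sN.2; [exact: xS | exact: yS].
Qed.

Lemma submoduleD M (N : set M) x y : submodule N -> N x -> N y -> N (x + y).
Proof. by move=> sN Nx Ny; rewrite -[x]scale1r; apply: sN.2. Qed.

Lemma submoduleB M (N : set M) x y : submodule N -> N x -> N y -> N (x - y).
Proof. by move=> sN Nx Ny; rewrite addrC -scaleN1r; apply: sN.2. Qed.

Lemma preimage_submodule A B (f : {linear A -> B}) (N : set B) :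
  submodule N -> submodule (f @^-1` N).
Proof.
move=> sN; split=> [|a x y Nx Ny]; rewrite /= ?linear0; first exact: sN.1.
by rewrite linearP; apply: sN.2.
Qed.

Lemma image_submodule A B (f : {linear A -> B}) (N : set A) :
  submodule N -> submodule (f @` N).
Proof.
move=> sN; split=> [|a _ _ [x Nx <-] [y Ny <-]].
  by exists 0; [exact: sN.1 | rewrite linear0].
by exists (a *: x + y); [apply: sN.2 | rewrite linearP].
Qed.

Definition noetherian_module M : Prop :=
  forall N : set M, submodule N -> exists s : seq M, gen s = N.

Lemma lift_seq A B (f : A -> B) (N : set A) (s : seq B) :
  (forall y, y \in s -> (f @` N) y) ->
  exists t : seq A, (forall x, x \in t -> N x) /\ [seq f x | x <- t] = s.
Proof.
elim: s => [|y s IH] ys; first by exists [::].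
have [x Nx fx] := ys y (mem_head _ _).
have [|t [tN tE]] := IH; first by move=> z zs; apply: ys; rewrite inE zs orbT.
exists (x :: t); split=> [z|/=]; last by rewrite fx tE.
by rewrite inE => /orP[/eqP-> // | /tN].
Qed.

Lemma noetherian_module_ext A B C (f : {linear A -> B}) (g : {linear B -> C}) :
  exact_at f g -> noetherian_module A -> noetherian_module C ->
  noetherian_module B.
Proof.
move=> fg Anoeth Cnoeth N sN.
have [sC sCE] := Cnoeth _ (image_submodule g sN).
have [sA sAE] := Anoeth _ (preimage_submodule f sN).
have [|t [tN tE]] := @lift_seq _ _ g N sC.
  by move=> y ys; rewrite -sCE => C' _; apply.
exists (t ++ [seq f x | x <- sA]); apply/seteqP; split=> x.
  apply=> // y /=; rewrite mem_cat => /orP[/tN //|/mapP[z zs ->]].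
  by have : gen sA z by [move=> C' _; apply]; rewrite sAE.
move=> Nx; set G := gen _; have sG : submodule G by apply: span_submodule.
have tG y : y \in t -> G y.
  by move=> yt C' _; apply; rewrite /= mem_cat yt.
(* Choosing [y] in [N] as well as in [G] puts [x - y] in [N], so its preimage under [f] is spanned
   by [sA]. *)
have [y [Gy Ny] gy] : (g @` (G `&` N)) (g x).
  have : (g @` N) (g x) by exists x.
  rewrite -sCE; apply.
    apply: image_submodule; split=> [|a z w [? ?] [? ?]].
      by split; [exact: sG.1 | exact: sN.1].
    by split; [apply: sG.2 | apply: sN.2].
  move=> z; rewrite /= -tE => /mapP[w wt ->]; exists w => //.
  by split; [exact: tG | exact: tN].
have /fg[a aE] : g (x - y) = 0 by rewrite linearB gy subrr.
have : (f @^-1` N) a by rewrite /= aE; apply: submoduleB.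
rewrite -sAE => /(_ (f @^-1` G) (preimage_submodule _ sG)) Ga.
rewrite -[x](subrK y) -aE; apply: (submoduleD sG _ Gy); apply: Ga => z zs C' _.
by apply; rewrite /= mem_cat (map_f f) ?orbT.
Qed.

Lemma noetherian_module_inj A B (f : {linear A -> B}) :
  injective f -> noetherian_module B -> noetherian_module A.
Proof.
move=> finj Bnoeth N sN.
have [s sE] := Bnoeth _ (image_submodule f sN).
have [|t [tN tE]] := @lift_seq _ _ f N s.
  by move=> y ys; rewrite -sE => C' _; apply.
exists t; apply/seteqP; split=> x; first exact.
move=> Nx; have : (f @` N) (f x) by exists x.
rewrite -sE => /(_ (f @` gen t) (image_submodule _ (span_submodule _))).
case=> [z|y yt /finj <- //]; rewrite /= -tE => /mapP[w wt ->].
by exists w => // C' _; apply.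
Qed.

Lemma rV_noetherian n : noetherian R -> noetherian_module 'rV[R]_n.
Proof.
move=> Rnoeth; elim: n => [|n IH].
  move=> N sN; exists [::]; apply/seteqP; split=> x; first by apply.
  by rewrite [x]thinmx0 => _; apply: (span_submodule _).1.
have rlin : linear (fun v : 'rV[R]_n => row_mx (0 : 'rV[R]_1) v).
  by move=> a v w; rewrite scale_row_mx add_row_mx scaler0 addr0.
have clin : linear (fun v : 'rV[R]_(1 + n) => v 0 0 : R^o).
  by move=> a v w; rewrite !mxE.
apply: (noetherian_module_ext (f := mk_hom rlin) (g := mk_hom clin)) => //.
move=> v; split=> /= [v0|[w <-]]; last first.
  have e : 0 = lshift n (0 : 'I_1) :> 'I_(1 + n) by exact: val_inj.
  by rewrite [X in row_mx _ _ _ X]e row_mxEl mxE.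
exists (rsubmx v); rewrite -[RHS]hsubmxK; congr row_mx.
apply/rowP => i; rewrite !mxE ord1 -v0; congr (v _ _); exact: val_inj.
Qed.

Lemma finitely_generated_cover M : finitely_generated M ->
  exists n (p : {linear 'rV[R]_n -> M}), surjective p.
Proof.
move=> [s sE].
pose p := mk_hom (rV_lift_linear (fun i : 'I_(size s) => s`_i)).
exists (size s), p => x.
have : gen s x by rewrite sE.
move=> /(_ (p @` setT)) []; last by move=> v; exists v.
  by apply: image_submodule.
move=> y /= ys; have ys' : (index y s < size s)%N by rewrite index_mem.
exists (delta_mx 0 (Ordinal ys')) => //.
by rewrite [LHS]rV_lift_delta nth_index.
Qed.

Lemma noetherian_ker_finitely_generated n M (p : {linear 'rV[R]_n -> M}) :
  noetherian R -> finitely_generated (ker p).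
Proof.
move=> /(@rV_noetherian n) rVnoeth.
have [||s sE] := @noetherian_module_inj _ _ (ker_incl p) _ rVnoeth setT.
- exact: ker_val_inj.
- by split.
- by exists s.
Qed.

End Noetherian.

(** * Units in a local ring *)

Section Local.
Variables (R : comNzRingType) (m : set R).
Hypothesis mloc : local_ring m.

Lemma proper_ideal_sub_maximal (I : set R) : ideal I -> ~ I 1 ->
  exists2 n, maximal_ideal n & I `<=` n.
Proof.
move=> iI I1.
have idealT (J : set R) : ideal J -> J 1 -> J = setT.
  move=> iJ J1; apply/seteqP; split=> // x _.
  by rewrite -[x]mulr1 -[x * 1]addr0; apply: iJ.2 => //; exact: iJ.1.
pose Q (J : set R) := J = set0 \/ [/\ ideal J, ~ J 1 & I `<=` J].
have [F FQ Ftot|A [QA Amax]] := @Zorn_bigcup R Q.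
  have [[J [FJ J0]]|F0] := pselect (exists J, F J /\ J <> set0); last first.
    left; apply/seteqP; split=> // x [J FJ Jx]; case: F0; exists J; split=> //.
    by move=> J0; rewrite J0 in Jx.
  have QF J' x : F J' -> J' x -> [/\ ideal J', ~ J' 1 & I `<=` J'].
    by move=> FJ' J'x; have [E|//] := FQ _ FJ'; rewrite E in J'x.
  have [//|[iJ J1 IJ]] := FQ _ FJ.
  right; split; last by move=> x Ix; exists J => //; apply: IJ.
    split; first by exists J => //; exact: iJ.1.
    move=> a x y [X FX Xx] [Y FY Yy].
    have [XY|YX] := Ftot _ _ FX FY.
      exists Y => //; have [iY _ _] := QF _ _ FY Yy.
      by apply: iY.2 => //; apply: XY.
    exists X => //; have [iX _ _] := QF _ _ FX Xx.
    by apply: iX.2 => //; apply: YX.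
  by move=> [X FX X1]; have [_ []] := QF _ _ FX X1.
have [iA A1 IA] : [/\ ideal A, ~ A 1 & I `<=` A].
  have [A0|//] := QA; exfalso; apply: (Amax I); last by right; split.
  by rewrite A0; split=> // /(_ 0 iI.1).
exists A => //; split=> // [AT|J iJ AJ]; first by apply: A1; rewrite AT.
have [J1|J1] := pselect (J 1); [by right; apply: idealT | left].
apply/seteqP; split=> //; apply: contrapT => nJA.
apply: (Amax J); first by split.
by right; split=> // x /IA /AJ.
Qed.

(** Otherwise the ideal generated by [a] is proper, so it lies in a maximal ideal, which can only be
    [m]. *)
Lemma local_ring_unit (a : R) : ~ m a -> exists b, b * a = 1.
Proof.
move=> ma; apply: contrapT => nb.
have iI : ideal [set x : R | exists b, b * a = x].
  split=> [|c _ _ [x <-] [y <-]]; first by exists 0; rewrite mul0r.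
  by exists (c * x + y); rewrite mulrDl [_ *: _]mulrA.
have [|n nmax In] := proper_ideal_sub_maximal iI.
  by move=> [b ba]; apply: nb; exists b.
by apply: ma; rewrite -(mloc.2 _ nmax); apply: In; exists 1; rewrite mul1r.
Qed.
End Local.

(** * Minimal covers and Ext into the residue field *)

Section MinimalCover.
Variables (R : comNzRingType) (m : set R).
Hypothesis mloc : local_ring m.
Implicit Types M : lmodType R.

(** Take the least number of generators: a relation with a unit coordinate would make one generator
    redundant. *)
Lemma minimal_cover M : finitely_generated M ->
  exists n (p : {linear 'rV[R]_n -> M}),
    surjective p /\ forall v, p v = 0 -> forall j, m (v 0 j).
Proof.
move=> /finitely_generated_cover ex.
pose Q n := `[< exists p : {linear 'rV[R]_n -> M}, surjective p >].
have exQ : exists n, Q n by have [n np] := ex; exists n; apply/asboolP.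
have [n /asboolP[p psurj] nmin] := ex_minnP exQ.
exists n, p; split=> // v pv j; apply: contrapT => mvj.
have [b bv] := local_ring_unit mloc mvj.
case: n p psurj nmin v pv j mvj bv => [? ? ? ? ? [] //|].
move=> n p psurj nmin v pv j mvj bv.
suff : Q n by move/nmin; rewrite ltnn.
apply/asboolP.
exists (mk_hom (rV_lift_linear (fun k => p (delta_mx 0 (lift j k))))) => x.
have [w <-] := psurj x.
(* Subtracting this multiple of the relation [v] keeps the image under [p] and clears coordinate
   [j]. *)
pose w' := w - (w 0 j * b) *: v.
have w'j : w' 0 j = 0 by rewrite !mxE -mulrA bv mulr1 subrr.
exists (\row_k w' 0 (lift j k)) => /=.
have -> : p w = p w' by rewrite linearB linearZ /= pv scaler0 subr0.
rewrite [RHS]rV_linearE (bigD1_ord j) //= w'j scale0r add0r.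
by apply: eq_bigr => k _; rewrite mxE.
Qed.

Local Notation k := (residue_field m).

Definition residue : {linear R^o -> k} := quo_map (m : set R^o).

Lemma residue0 (a : R) : residue a = 0 <-> m a.
Proof.
rewrite quo_map0; split=> [|ma N _]; last exact.
by apply=> //; have [[]] := mloc.
Qed.

Lemma residue_scale (a : R) (x : k) : m a -> a *: x = 0.
Proof.
move=> ma; have [b <-] := quo_map_surj x.
rewrite -linearZ; apply/residue0; rewrite [_ *: _]mulrC -[_ * _]addr0.
by have [[[m0 mP] _ _] _] := mloc; apply: mP.
Qed.

Lemma extends_residue_free M n (p : {linear 'rV[R]_n -> M}) :
  noetherian R -> surjective p -> (forall v, p v = 0 -> forall j, m (v 0 j)) ->
  extends p k -> free_fin M.
Proof.
move=> Rnoeth psurj pmin pk.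
exists n, p; apply: inj_surj_bij => //; apply: linear_inj => v pv.
have [r [q [qsurj qmin]]] :=
  minimal_cover (noetherian_ker_finitely_generated p Rnoeth).
case: r q qsurj qmin => [|r] q qsurj qmin.
  have /ker_incl_exact[z <-] := pv.
  by have [w <-] := qsurj z; rewrite [w]thinmx0 linear0.
(* Minimality of [q] lets the residue of the first coordinate descend to a map [u] from [ker p] to
   [k]. *)
have clin : linear (fun v : 'rV[R]_r.+1 => residue (v 0 0)).
  by move=> a w w'; rewrite !mxE linearD -linearZ.
have [|u uE] := factor_surj (z := mk_hom clin) qsurj.
  by move=> w /qmin/(_ 0) mw; apply/residue0.
have [w wE] := pk u.
(* The extension [w] kills vectors with coordinates in [m], hence all of [ker p]; but [u] takes the
   class of 1 here, which would force 1 into [m]. *)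
have : u (q (delta_mx 0 0)) = 0.
  rewrite -wE [LHS]rV_linearE big1 // => i _; apply: residue_scale.
  by apply: pmin; apply: ker_valP.
rewrite uE /= mxE !eqxx => /residue0 m1.
have [[[m0 mP] mT _] _] := mloc; case: mT; apply/seteqP; split=> // x _.
by rewrite -[x]mulr1 -[_ * _]addr0; apply: mP.
Qed.

Variable M0 : lmodType R.
Hypothesis Rnoeth : noetherian R.

(** The canonical syzygies need not be finitely generated, so a finitely generated stable retract
    [M] stands in for the [i]-th one. *)
Lemma free_of_Ext_residue M i : finitely_generated M ->
  stable_retract M (free_syzygy M0 i) -> Ext_vanishes M0 i k -> free_fin M.
Proof.
move=> /minimal_cover[n [p [psurj pmin]]] MZ E0.
apply: extends_residue_free pmin _ => //.
apply: stable_retract_extends MZ _ E0 => //; first exact: rV_projective.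
  exact: malg_projective.
exact: free_cover_surj.
Qed.

Lemma stable_retract_free_syzygy M n (p : {linear 'rV[R]_n -> M}) i :
  surjective p -> stable_retract M (free_syzygy M0 i) ->
  stable_retract (ker p) (free_syzygy M0 i.+1).
Proof.
move=> psurj MZ; apply: stable_retract_ker MZ => //; first exact: rV_projective.
  exact: malg_projective.
exact: free_cover_surj.
Qed.

Lemma finite_proj_dim_of_Ext_residue N : finitely_generated M0 ->
  Ext_vanishes M0 N k -> finite_proj_dim M0.
Proof.
move=> fgM0 E0.
(* Induction on the distance [l] to the degree [N], where the stand-in for the syzygy is free. *)
suff fpd l : forall i M, (i + l)%N = N -> finitely_generated M ->
    stable_retract M (free_syzygy M0 i) -> finite_proj_dim M.
  by apply: (fpd N 0%N M0) => //; apply: stable_retract_refl.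
elim: l => [|l IH] i M.
  rewrite addn0 => -> fgM MZ.
  apply/projective_finite_proj_dim/free_fin_projective.
  exact: free_of_Ext_residue MZ E0.
move=> il fgM MZ; have [n [p psurj]] := finitely_generated_cover fgM.
apply: (finite_proj_dim_ker (p := p)) => //; first exact: rV_projective.
apply: (IH i.+1); first by rewrite addSnnS.
  exact: noetherian_ker_finitely_generated.
exact: stable_retract_free_syzygy.
Qed.

Lemma free_of_Ext_residue_ring N : finitely_generated M0 ->
  (forall i, Ext_vanishes M0 i R^o) -> Ext_vanishes M0 N k -> free_fin M0.
Proof.
move=> fgM0 ER E0.
suff free l : forall i M, (i + l)%N = N -> finitely_generated M ->
    stable_retract M (free_syzygy M0 i) -> free_fin M.
  by apply: (free N 0%N M0) => //; apply: stable_retract_refl.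
elim: l => [|l IH] i M.
  by rewrite addn0 => -> fgM MZ; apply: free_of_Ext_residue MZ E0.
move=> il fgM MZ; have [n [p [psurj pmin]]] := minimal_cover fgM.
apply: extends_residue_free (pmin) _ => //.
(* Once [ker p] is free, vanishing of Ext^1(M, R) gives Ext^1(M, k) = 0, so the freeness criterion
   for minimal covers applies to [M] itself. *)
apply: extends_ker; apply: extends_free_fin.
  apply: stable_retract_extends MZ _ (ER i) => //; first exact: rV_projective.
    exact: malg_projective.
  exact: free_cover_surj.
apply: (IH i.+1); first by rewrite addSnnS.
  exact: noetherian_ker_finitely_generated.
exact: stable_retract_free_syzygy.
Qed.

End MinimalCover.

(** * Regular sequences, direct summands and vanishing of Ext *)

Section RegularSequence.
Variable R : comNzRingType.
Implicit Types C M : lmodType R.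

Lemma mod_seq_rcons_exact C (xs : seq R) (x : R) :
  (forall z : mod_seq C xs, x *: z = 0 -> z = 0) ->
  exists (f : {linear mod_seq C xs -> mod_seq C xs})
         (g : {linear mod_seq C xs -> mod_seq C (rcons xs x)}),
    short_exact f g.
Proof.
move=> xreg.
have flin : linear (fun z : mod_seq C xs => x *: z).
  by move=> a y z; rewrite scalerDr !scalerA mulrC.
pose S := [set y : C | exists2 a : R, a \in xs & exists z : C, y = a *: z].
pose S' :=
  [set y : C | exists2 a : R, a \in rcons xs x & exists z : C, y = a *: z].
have SS' y : Defs.span S y -> Defs.span S' y.
  apply; first exact: span_submodule.
  move=> _ [a axs [z ->]] N _; apply; exists a; last by exists z.
  by rewrite mem_rcons inE axs orbT.
have [|g gE] := factor_surj (z := quo_map S') (quo_map_surj (S := S)).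
  by move=> y /quo_map0 /SS' /quo_map0.
exists (mk_hom flin), g; split.
- exact: linear_inj.
- move=> y; have [b <-] := quo_map_surj y; split.
    rewrite gE => /quo_map0 S'b.
    suff [c Sc] : exists c, Defs.span S (b - x *: c).
      exists (quo_map S c); rewrite -[LHS]/(x *: quo_map S c) -linearZ.
      apply/esym/eqP; rewrite -subr_eq0 -linearB; apply/eqP/quo_map0.
      exact: Sc.
    (* These are the elements congruent to a multiple of [x] modulo [xs]; as a submodule containing
       the generators [S'], it contains their span. *)
    pose N := [set b : C | exists c, Defs.span S (b - x *: c)].
    apply: (S'b N).
      split=> [|a y1 y2 [c1 Sc1] [c2 Sc2]].
        by exists 0; rewrite scaler0 subr0; apply: (span_submodule S).1.
      exists (a *: c1 + c2).
      have -> : a *: y1 + y2 - x *: (a *: c1 + c2) =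
                a *: (y1 - x *: c1) + (y2 - x *: c2).
        by rewrite scalerDr scalerBr !scalerA mulrC opprD addrACA.
      exact: (span_submodule S).2.
    move=> _ [a + [z ->]]; rewrite mem_rcons inE => /orP[/eqP ->|axs].
      by exists z; rewrite subrr; apply: (span_submodule S).1.
    exists 0; rewrite scaler0 subr0 => N' _; apply.
    by exists a => //; exists z.
  move=> [z <-]; have [c <-] := quo_map_surj z.
  rewrite -[mk_hom flin _]/(x *: quo_map S c) -linearZ gE.
  apply/quo_map0 => N _; apply.
  by exists x; [rewrite mem_rcons mem_head | exists c].
- move=> y; have [b <-] := quo_map_surj y.
  by exists (quo_map S b); rewrite gE.
Qed.

(** Each quotient is the cokernel of multiplication by the next element on the previous quotient,
    and the cokernel step only raises degrees, so the bound [n] is kept. *)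
Lemma Ext_vanishes_mod_seq M C (xs : seq R) n : regular_sequence C xs ->
  (forall i, (n <= i)%N -> Ext_vanishes M i C) ->
  forall i, (n <= i)%N -> Ext_vanishes M i (mod_seq C xs).
Proof.
move=> [xsreg _] CE.
suff take_ext l : (l <= size xs)%N ->
    forall i, (n <= i)%N -> Ext_vanishes M i (mod_seq C (take l xs)).
  by rewrite -[X in mod_seq C X]take_size; apply: take_ext.
elim: l => [|l IH] lxs i ni.
  (* For the empty sequence the quotient map is an isomorphism, with inverse [s]. *)
  rewrite take0.
  pose S := [set y : C | exists2 a : R, a \in [::] & exists z : C, y = a *: z].
  have idlin : linear (fun x : C => x) by [].
  have [|s sE] := factor_surj (z := mk_hom idlin) (quo_map_surj (S := S)).
    move=> y /quo_map0 /(_ [set 0]); apply; last by move=> z [].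
    by split=> // a u v /= -> ->; rewrite scaler0 addr0.
  apply: (Ext_vanishes_retract (s := s) (r := quo_map S)); last exact: CE.
  by move=> z; have [y <-] := quo_map_surj z; rewrite sE.
have [f [g fg]] := mod_seq_rcons_exact (xsreg l lxs).
rewrite (take_nth 0 lxs).
apply: (Ext_vanishes_cokernel fg); apply: IH; rewrite ?(ltnW lxs) //.
exact: leqW.
Qed.

Lemma Ext_vanishes_direct_summand M i X Y :
  direct_summand X Y -> Ext_vanishes M i Y -> Ext_vanishes M i X.
Proof.
move=> [L [f [f' fK f'K]]].
have slin : linear (fun x : X => f (x, 0)).
  move=> a x y; rewrite -linearP; congr (f _).
  by rewrite [RHS]surjective_pairing /= scaler0 addr0.
have rlin : linear (fun y : Y => (f' y).1).
  move=> a x y; have -> : a *: x + y = f (a *: f' x + f' y).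
    by rewrite linearP !f'K.
  by rewrite fK.
apply: (Ext_vanishes_retract (s := mk_hom slin) (r := mk_hom rlin)) => x.
by rewrite /= fK.
Qed.

End RegularSequence.

(** * G-regularity and the generalized Auslander-Reiten condition *)

Theorem corollary2p8 (R : comNzRingType) (m : set R) (d : nat)
    (omega C : lmodType R)
    (f : {linear R^o -> omega}) (g : {linear omega -> C}) (xs : seq R)
    (hR : cohen_macaulay_local m d)
    (d_gt0 : (0 < d)%N)
    (h_omega : canonical_module m omega)
    (hfg : short_exact f g)
    (hC : ~ zero_module C)
    (size_xs : size xs = d.-1)
    (xs_in_m : forall a, a \in xs -> m a)
    (xs_R : regular_sequence R^o xs)
    (xs_C : regular_sequence C xs)
    (hk : direct_summand (residue_field m) (mod_seq C xs)) :
  G_regular R /\ generalized_Auslander_Reiten R.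
Proof.
have [Rnoeth mloc _ _] := hR; have [_ _ _ omega_fin] := h_omega.
have Ext_residue M n : (forall i, (n <= i)%N -> Ext_vanishes M i R^o) ->
    exists N, Ext_vanishes M N (residue_field m).
  move=> ER; have [l El] := Ext_vanishes_finite_inj_dim M omega_fin.
  (* Beyond [n] Ext into [R] vanishes, beyond [l] Ext into [omega]. *)
  exists (maxn n l).
  apply: (Ext_vanishes_direct_summand hk).
  apply: (Ext_vanishes_mod_seq (n := maxn n l)) => // i.
  rewrite geq_max => /andP[ni li]; apply: (Ext_vanishes_cokernel hfg).
    exact: El.
  by apply: ER; apply: leqW.
split=> [M fgM [_ _ EM] | M fgM [n EM]].
  have ER i : Ext_vanishes M i R^o by apply/Ext_vanishesP; case: (EM i.+1).
  have [|N EN] := @Ext_residue M 0%N; first by move=> i _.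
  exact: free_of_Ext_residue_ring ER EN.
have [|N EN] := @Ext_residue M n.
  (* [R^o] is a summand of [M * R^o] with complement [M], after swapping the factors. *)
  move=> i ni; apply: (@Ext_vanishes_direct_summand _ _ _ _ (M * R^o)%type).
    exists M.
    have slin : linear (fun x : (R^o * M)%type => (x.2, x.1)) by [].
    exists (mk_hom slin).
    by exists (fun x => (x.2, x.1)); case.
  by apply/Ext_vanishesP/EM/leqW.
exact: finite_proj_dim_of_Ext_residue EN.
Qed.
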